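(* Let $\mathrm{Pnest}_{\mathcal A(0)}(t)=1$ and, for $n\ge1$, $\mathrm{Pnest}_{\mathcal A(n)}(t)=\sum_{\mathbf a\in\mathcal A(n)}t^{\mathrm{pnest}(\mathbf a)}$, where $\mathcal A(n)$ is the set of Abelian area sequences of size $n$. Then $\mathrm{Pnest}_{\mathcal A(1)}(t)=t$, $\mathrm{Pnest}_{\mathcal A(2)}(t)=2t$, and for $n\ge 3$ $$\mathrm{Pnest}_{\mathcal A(n)}(t)=2\,\mathrm{Pnest}_{\mathcal A(n-1)}(t)+(t-1)\,\mathrm{Pnest}_{\mathcal A(n-2)}(t).$$ Moreover, $\mathrm{Pnest}_{\mathcal A(n)}(t)$ is real-rooted for every $n\ge0$, and $\{\mathrm{Pnest}_{\mathcal A(n)}(t)\}_{n\ge0}$ is a generalized Sturm sequence.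
   Context: Write $[n]=\{1,\dots,n\}$. An area sequence of size $n$ is a sequence $\mathbf a=(a_1,\dots,a_n)$ of nonnegative integers with $a_i<i$ for all $i$ and $a_i\le a_{i-1}+1$ for all $i\ge 2$. Each area sequence $\mathbf a$ defines a graph $\Gamma_{\mathbf a}$ (a unit interval graph) on $[n]$ with edges $\{j,i\}$ for $1\le j<i\le n$ with $i-a_i\le j$. If $\{i,j\}$ with $i<j$ is an edge then $\{i,i+1,\dots,j\}$ is a clique. A peak-edge of $\Gamma_{\mathbf a}$ is either an isolated vertex $i$ (put $j=i$) or an edge $\{i,j\}$, $i<j$, such that neither $\{i,j+1\}$ nor $\{i-1,j\}$ is an edge (pairs not contained in $[n]$ are not edges). The corresponding peak-clique is $\{i,i+1,\dots,j\}$. The peak-nesting of a vertex is the number of peak-cliques containing it, and $\mathrm{pnest}(\mathbf a)$ is the maximum of these numbers over all vertices. An area sequence $\mathbf a$ of size $n$ is Abelian if every vertex $i\ne 1,n$ of $\Gamma_{\mathbf a}$ is adjacent to at least one of the vertices $1$ and $n$. A real polynomial is real-rooted if all its zeros are real (constants are real-rooted). For real-rooted $f,g$ with positive leading coefficients and zeros (with multiplicity) $\cdots\le\lambda_2\le\lambda_1$ and $\cdots\le\delta_2\le\delta_1$ respectively, write $g\ll f$ if $\cdots\le\delta_2\le\lambda_2\le\delta_1\le\lambda_1$ (so the degrees differ by at most one, $\deg g\le\deg f$); by convention also $0\ll0$, $0\ll f$, $f\ll0$. A sequence $\{f_i\}_{i\ge0}$ of real-rooted polynomials with positive leading coefficients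 is a generalized Sturm sequence if $f_{i-1}\ll f_i$ for all $i\ge1$. *)

(* Defs.v *)
From HB Require Import structures.
From mathcomp Require Import all_boot all_order all_algebra.
From mathcomp Require Import reals complex.

Set Implicit Arguments.
Unset Strict Implicit.
Unset Printing Implicit Defensive.

Import Order.TTheory GRing.Theory Num.Theory.

(* The vertex set {1, ..., n} is 'I_n, so the vertex m of the mathematics is
   the ordinal of value m - 1.  The entries of an area sequence are < n, so
   sequences of size n live in the finite type {ffun 'I_n -> 'I_n}; with the
   shifted indices the condition a_i < i reads a i <= i. *)
Definition is_area_seq (n : nat) (a : {ffun 'I_n -> 'I_n}) : bool :=
  [forall i : 'I_n, a i <= i] &&
  [forall i : 'I_n, forall j : 'I_n, (j == i.+1 :> nat) ==> (a j <= (a i).+1)].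

(* The condition i - a_i <= j is invariant under the shift of i and j, and the
   truncated subtraction is exact on area sequences. *)
Definition ua_edge (n : nat) (a : {ffun 'I_n -> 'I_n}) : rel 'I_n :=
  fun x y => ((x < y) && (y - a y <= x)) || ((y < x) && (x - a x <= y)).

Definition isolated (n : nat) (a : {ffun 'I_n -> 'I_n}) (i : 'I_n) : bool :=
  [forall k : 'I_n, ~~ ua_edge a i k].

(* The pair (i, i) stands for the isolated vertex i. *)
Definition peak_edge (n : nat) (a : {ffun 'I_n -> 'I_n}) (e : 'I_n * 'I_n)
    : bool :=
  let: (i, j) := e in
  ((i == j) && isolated a i) ||
  [&& i < j, ua_edge a i j,
      [forall k : 'I_n, (k == j.+1 :> nat) ==> ~~ ua_edge a i k]
    & [forall k : 'I_n, (k.+1 == i :> nat) ==> ~~ ua_edge a k j]].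

Definition peak_clique (n : nat) (e : 'I_n * 'I_n) : {set 'I_n} :=
  [set k : 'I_n | e.1 <= k <= e.2].

Definition peak_cliques (n : nat) (a : {ffun 'I_n -> 'I_n})
    : {set {set 'I_n}} :=
  [set peak_clique e | e in [pred e | peak_edge a e]].

Definition peak_nesting (n : nat) (a : {ffun 'I_n -> 'I_n}) (v : 'I_n) : nat :=
  #|[set C in peak_cliques a | v \in C]|.

Definition pnest (n : nat) (a : {ffun 'I_n -> 'I_n}) : nat :=
  \max_(v < n) peak_nesting a v.

Definition is_abelian (n : nat) (a : {ffun 'I_n -> 'I_n}) : bool :=
  [forall i : 'I_n, (i != 0 :> nat) && (i != n.-1 :> nat) ==>
    [exists k : 'I_n, ((k == 0 :> nat) || (k == n.-1 :> nat))
                      && ua_edge a i k]].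

Definition abelian_area_seqs (n : nat) : {set {ffun 'I_n -> 'I_n}} :=
  [set a | is_area_seq a && is_abelian a].

Local Open Scope ring_scope.

Definition PnestA (R : realType) (n : nat) : {poly R} :=
  if n is 0%N then 1 else \sum_(a in abelian_area_seqs n) 'X^(pnest a).

(* Constants, including 0, count as real-rooted. *)
Definition real_rooted (R : realType) (p : {poly R}) : Prop :=
  (size p <= 1)%N \/
  forall z : R[i], root (map_poly (real_complex R) p) z -> z \is Num.real.

(* s lists the real zeros of p <> 0 in nonincreasing order, each repeated
   according to its multiplicity. *)
Definition zeros_of (R : realType) (p : {poly R}) (s : seq R) : Prop :=
  sorted >=%R s /\ forall x : R, count_mem x s = mup x p.

Definition interlacing_seqs (R : realType) (d l : seq R) : Prop :=
  [/\ (size d <= size l <= (size d).+1)%N,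
      forall i : nat, (i < size d)%N -> d`_i <= l`_i
    & forall i : nat, (i.+1 < size l)%N -> l`_i.+1 <= d`_i].

Definition real_rooted_pos (R : realType) (p : {poly R}) : Prop :=
  real_rooted p /\ 0 < lead_coef p.

(* interlaces g f is g << f, including 0 << 0, 0 << f and f << 0. *)
Definition interlaces (R : realType) (g f : {poly R}) : Prop :=
  [/\ g = 0 \/ real_rooted_pos g,
      f = 0 \/ real_rooted_pos f
    & g != 0 -> f != 0 ->
      exists d l : seq R,
        [/\ zeros_of g d, zeros_of f l & interlacing_seqs d l]].

Definition generalized_sturm (R : realType) (F : nat -> {poly R}) : Prop :=
  (forall i : nat, real_rooted_pos (F i)) /\
  (forall i : nat, (1 <= i)%N -> interlaces (F i.-1) (F i)).

(* Main.v *)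
Require Import Defs.
From mathcomp Require Import all_boot all_order all_algebra.
From mathcomp Require Import reals trigo complex ring zify.

(* Encode an area sequence by the leftmost neighbours h(i) = i - a_i, a
   nondecreasing sequence.  It is Abelian iff h vanishes left of l = h(n - 1)
   (vertices numbered from 0), so it amounts to a nondecreasing sequence
   h(l) <= ... <= h(n - 1) = l, i.e. to a lattice path, i.e. to a word of n - 1
   bits.  The peak-cliques correspond to the values of h, and the vertex l lies
   in all of them that end at or after l, which is the best possible; hence
   pnest is the number of distinct values of h on [l, n - 1].  Removing the
   first letter of the word gives the recurrence.
   By the recurrence and the addition formulas,
     Pnest_n(- tan^2 t) cos^(n+1) t = - sin t sin (n t),
   so the zeros of Pnest_n are the numbers - tan^2 (k pi / n), 0 <= k < n / 2,
   and these interlace because k / n decreases with n. *)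

Set Implicit Arguments.
Unset Strict Implicit.
Unset Printing Implicit Defensive.

Import Order.TTheory GRing.Theory Num.Theory.

(** * Lattice paths and their recorded heights *)

(* The word w is the lattice path whose letters [true] raise the current
   height, which starts at c, and whose letters [false] record it; the final
   height is recorded once more. *)
Fixpoint staircase (c : nat) (w : seq bool) : seq nat :=
  match w with
  | [::] => [:: c]
  | true :: w' => staircase c.+1 w'
  | false :: w' => c :: staircase c w'
  end.

Lemma size_staircase c w : size (staircase c w) = (count negb w).+1.
Proof. by elim: w c => [|[] w IHw] c //=; rewrite IHw. Qed.

Lemma last_staircase d c w : last d (staircase c w) = c + count id w.
Proof. by elim: w d c => [|[] w IHw] d c //=; rewrite ?addn0 // IHw ?addSnnS. Qed.

Lemma staircase_bounds c w x :
  x \in staircase c w -> c <= x <= c + count id w.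
Proof.
elim: w c => [|[] w IHw] c /=; first by rewrite inE => /eqP->; lia.
  by move/IHw; lia.
by rewrite inE => /orP[/eqP->|/IHw]; lia.
Qed.

Lemma staircase_path d c w : d <= c -> path leq d (staircase c w).
Proof.
elim: w d c => [|[] w IHw] d c dc /=; rewrite ?dc //; last exact: IHw.
by apply: IHw; apply: leqW.
Qed.

(** After a first letter [true] all recorded heights exceed c, whereas otherwise the first one is c;
    the empty word and a word starting with [false] differ in the number of recorded heights. *)
Lemma staircase_inj c w w' : staircase c w = staircase c w' -> w = w'.
Proof.
have head_neq b v v' : staircase b.+1 v <> b :: v'.
  move=> E; have := @staircase_bounds b.+1 v b.
  by rewrite E inE eqxx => /(_ isT); lia.
elim: w c w' => [|[] w IHw] c [|[] w'] //= E.
- by case: (head_neq c w' [::]).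
- by case: E => /esym/(congr1 size); rewrite size_staircase.
- by case: (head_neq c w [::]).
- by congr (_ :: _); apply: IHw E.
- by case: (head_neq c w _ E).
- by case: E => /(congr1 size); rewrite size_staircase.
- by case: (head_neq c w' _ (esym E)).
- by case: E => /IHw ->.
Qed.

Lemma staircase_nseq c k w :
  staircase c (nseq k true ++ w) = staircase (c + k) w.
Proof. by elim: k c => [|k IHk] c; rewrite ?addn0 //= IHk addSnnS. Qed.

(** Climbing x - c times leads to the first height; a letter [false] records it unless it is the
    last one, which the end of the word records. *)
Lemma staircase_surj c x s :
  path leq c (x :: s) -> exists w, staircase c w = x :: s.
Proof.
elim: s c x => [|y s IHs] c x /= /andP[cx xs].
  by exists (nseq (x - c) true); rewrite -[nseq _ _]cats0 staircase_nseq subnKC.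
have [w Ew] := IHs x y xs; exists (nseq (x - c) true ++ false :: w).
by rewrite staircase_nseq subnKC //= Ew.
Qed.

Fixpoint words (m : nat) : seq (seq bool) :=
  if m is m'.+1 then
    [seq true :: w | w <- words m'] ++ [seq false :: w | w <- words m']
  else [:: [::]].

Lemma mem_words m w : (w \in words m) = (size w == m).
Proof.
elim: m w => [|m IHm] w /=; first by rewrite inE size_eq0.
rewrite mem_cat; have cons_inj b : injective (cons b : seq bool -> _).
  by move=> u v [].
have no b v : (b :: v \in [seq ~~ b :: w0 | w0 <- words m]) = false.
  by apply/negbTE/mapP => -[u _] []; case: b.
case: w => [|[] w] /=.
- by apply/negbTE; rewrite negb_or; apply/andP; split; apply/mapP=> -[].
- by rewrite mem_map // (no true) orbF IHm eqSS.
- by rewrite (no false) mem_map // IHm eqSS.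
Qed.

Lemma words_uniq m : uniq (words m).
Proof.
elim: m => //= m IHm; have cons_inj b : injective (cons b : seq bool -> _).
  by move=> u v [].
rewrite cat_uniq !map_inj_uniq // IHm andbT /=.
by apply/hasPn => _ /mapP[u _ ->]; apply/mapP => -[].
Qed.

(** * Abelian area sequences as words *)

Definition left_end n (a : {ffun 'I_n -> 'I_n}) (i : 'I_n) : nat := i - a i.

(** The condition on consecutive entries says that [left_end] does not decrease from one vertex to
    the next. *)
Lemma area_seqP n (a : {ffun 'I_n -> 'I_n}) :
  reflect ((forall i, a i <= i) /\ {homo left_end a : i j / i <= j})
          (is_area_seq a).
Proof.
rewrite /left_end; apply: (iffP andP) => -[Ha Hs].
  move: Ha Hs => /forallP Ha /forallP Hs; split=> // i j.
  case: j => j; elim: j => [|j IHj] ltj /= ij.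
    by have -> : i = Ordinal ltj by apply: val_inj => /=; lia.
  have [ij'|ji] := leqP i j; last first.
    by have -> : i = Ordinal ltj by apply: val_inj => /=; lia.
  have ltj' : j < n by lia.
  have /= := IHj ltj' ij'.
  have /forallP/(_ (Ordinal ltj))/implyP/= := Hs (Ordinal ltj').
  by rewrite eqxx => /(_ isT); have /= := Ha (Ordinal ltj); have /= := Ha (Ordinal ltj'); lia.
split; first exact/forallP.
apply/forallP => i; apply/forallP => j; apply/implyP => /eqP ij.
by have := Hs i j; have := Ha i; have := Ha j; rewrite ij; lia.
Qed.

(** Inner vertices from [left_end a ord_max] on are adjacent to the last vertex; those before it are
    not, so they must be adjacent to vertex 0. *)
Lemma abelianP m (a : {ffun 'I_m.+1 -> 'I_m.+1}) : is_area_seq a ->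
  reflect (forall i : 'I_m.+1, i < left_end a ord_max -> left_end a i = 0)
          (is_abelian a).
Proof.
move=> /area_seqP[Ha Hm]; have le_end i : left_end a i <= left_end a ord_max.
  by apply: Hm; rewrite -ltnS.
move: le_end; rewrite /left_end /is_abelian /ua_edge => le_end.
apply: (iffP forallP) => H i.
  move=> lti; have [i0|i0] := posnP i; first by rewrite i0.
  have inner : (i != 0 :> nat) && (i != m.+1.-1 :> nat).
    by move: lti => /=; lia.
  have /implyP/(_ inner) := H i.
  move=> /existsP[k /andP[/orP[]/eqP k0]].
    by rewrite k0; lia.
  have -> : k = ord_max by apply: val_inj.
  by move: lti => /=; lia.
apply/implyP => /andP[i0 im]; apply/existsP.
have [lti|lei] := ltnP i (left_end a ord_max).
  by exists ord0; have := H i lti; rewrite /=; lia.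
by exists ord_max; have := ltn_ord i; move: im lei; rewrite /left_end /=; lia.
Qed.

(** The final height [count id w] is the left end of the last vertex. The vertices before it get
    left end 0, the others the recorded heights. *)
Definition area_of_word m (w : seq bool) : {ffun 'I_m.+1 -> 'I_m.+1} :=
  [ffun i : 'I_m.+1 =>
     inord (i - nth 0 (nseq (count id w) 0 ++ staircase 0 w) i)].

(** Heights are recorded from position [count id w] on and never exceed this number. Hence the
    subtraction in [area_of_word] is exact and can be undone. *)
Lemma nth_word_le w i : nth 0 (nseq (count id w) 0 ++ staircase 0 w) i <= i.
Proof.
rewrite nth_cat nth_nseq size_nseq; case: ltnP => //= li.
have [lts|ges] := ltnP (i - count id w) (size (staircase 0 w)).
  by have /andP[_ /leq_trans->] := staircase_bounds (mem_nth 0 lts).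
by rewrite nth_default.
Qed.

Lemma left_end_word m w i :
  left_end (area_of_word m w) i
  = nth 0 (nseq (count id w) 0 ++ staircase 0 w) i.
Proof.
rewrite /left_end ffunE inordK; first by have := nth_word_le w i; lia.
by have := ltn_ord i; lia.
Qed.

Lemma size_word_seq w :
  size (nseq (count id w) 0 ++ staircase 0 w) = (size w).+1.
Proof.
by rewrite size_cat size_nseq size_staircase addnS -(count_predC id w).
Qed.

Lemma left_end_word_max m w : size w = m ->
  left_end (area_of_word m w) ord_max = count id w.
Proof.
move=> sw; rewrite left_end_word.
have -> : nat_of_ord (@ord_max m)
  = (size (nseq (count id w) 0 ++ staircase 0 w)).-1.
  by rewrite size_word_seq.
by rewrite nth_last last_cat last_staircase.
Qed.

Lemma area_of_word_abelian m w : size w = m ->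
  area_of_word m w \in abelian_area_seqs m.+1.
Proof.
move=> sw; have Ha : is_area_seq (area_of_word m w).
  apply/area_seqP; split=> i.
    by rewrite ffunE inordK; have := ltn_ord i; lia.
  move=> j ij; rewrite !left_end_word.
  apply: (sorted_leq_nth leq_trans leqnn); rewrite ?inE ?size_word_seq ?sw //.
  case: (w) => [|b w'] //; rewrite /sorted; case E: (_ ++ _) => // [y s].
  have : path leq 0 (nseq (count id (b :: w')) 0 ++ staircase 0 (b :: w')).
    rewrite cat_path; apply/andP; split; first by elim: (count _ _).
    by apply: staircase_path; elim: (count _ _).
  by rewrite E => /andP[].
rewrite inE Ha; apply/(abelianP Ha) => i; rewrite left_end_word_max //.
by rewrite left_end_word nth_cat nth_nseq size_nseq => ->.
Qed.

Lemma area_of_word_inj m :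
  {in [pred w | size w == m] &, injective (area_of_word m)}.
Proof.
move=> w w' /eqP sw /eqP sw' E; apply: (@staircase_inj 0).
have El : count id w = count id w'.
  by rewrite -(left_end_word_max sw) E (left_end_word_max sw').
have : nseq (count id w) 0 ++ staircase 0 w
     = nseq (count id w') 0 ++ staircase 0 w'.
  apply: (@eq_from_nth _ 0); rewrite !size_word_seq ?sw ?sw' // => i lti.
  by have := left_end_word w (Ordinal lti); rewrite E left_end_word.
by rewrite El => /eqP; rewrite eqseq_cat // eqxx => /eqP.
Qed.

Lemma abelian_area_of_word m a : a \in abelian_area_seqs m.+1 ->
  exists2 w, size w = m & a = area_of_word m w.
Proof.
rewrite inE => /andP[Ha /(abelianP Ha) H0].
have /area_seqP[Hle Hm] := Ha.
set l := left_end a ord_max in H0.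
have lm : l <= m by rewrite /l /left_end /=; lia.
pose s := [seq left_end a i | i <- enum 'I_m.+1].
have ss : size s = m.+1 by rewrite size_map size_enum_ord.
have ns (i : 'I_m.+1) : nth 0 s i = left_end a i.
  by rewrite (nth_map ord0) ?size_enum_ord // nth_ord_enum.
have [w Ew] : exists w, staircase 0 w = drop l s.
  case E: (drop l s) => [|x p].
    by move: (congr1 size E); rewrite size_drop ss /=; lia.
  apply: staircase_surj; rewrite /= -/(sorted leq (x :: p)) -E.
  apply: drop_sorted; apply/(sortedP 0) => i; rewrite ss => lti.
  have lti' : i < m.+1 by lia.
  by have := ns (Ordinal lti); have := ns (Ordinal lti') => /= -> ->; apply: Hm => /=.
have cw : count id w = l.
  rewrite -[LHS]add0n -(last_staircase 0) Ew -nth_last nth_drop size_drop ss.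
  transitivity (nth 0 s (@ord_max m)); last exact: ns.
  by congr (nth _ _ _) => /=; lia.
(* There are m + 1 - l recorded heights, hence m - l letters [false], besides the l letters
   [true]. *)
have sw : size w = m.
  have := congr1 size Ew; rewrite size_drop size_staircase ss.
  by have := count_predC id w; rewrite cw -[count (predC _) _]/(count negb w); lia.
exists w => //; apply/ffunP => i; apply: val_inj.
transitivity (i - left_end a i).
  by rewrite /left_end /=; have := Hle i; lia.
rewrite ffunE /= inordK; last by have := ltn_ord i; lia.
congr (_ - _).
rewrite cw Ew nth_cat nth_nseq size_nseq; case: ltnP => li.
  by rewrite H0.
by rewrite nth_drop subnKC // ns.
Qed.

(** * Peak-cliques and the peak-nesting *)

(* The vertex j is the last one with its value of [left_end]. *)
Definition block_end n (a : {ffun 'I_n -> 'I_n}) (j : 'I_n) : bool :=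
  [forall k : 'I_n, (j < k) ==> (left_end a j < left_end a k)].

(** The first condition forbids extending the clique to the left, the second to the right; an
    isolated vertex is the case i = j. *)
Lemma peak_edgeE n (a : {ffun 'I_n -> 'I_n}) i j : is_area_seq a ->
  peak_edge a (i, j) = (i == left_end a j :> nat) && block_end a j.
Proof.
move=> /area_seqP[Ha Hm]; have le j' : left_end a j' <= j' by exact: leq_subr.
apply/idP/andP => /=.
  move=> /orP[/andP[/eqP <- /forallP iso]|/and4P[ij eij /forallP Hk /forallP Hk']].
    have Ei : left_end a i = i.
      apply/eqP; rewrite eqn_leq le leqNgt /=; apply/negP => lt.
      have /negP[] := iso (Ordinal (leq_trans lt (ltnW (ltn_ord i)))).
      by move: lt; rewrite /ua_edge /left_end /=; lia.
    rewrite Ei eqxx; split=> //; apply/forallP => k; apply/implyP => ik.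
    by have := iso k; rewrite Ei /ua_edge /left_end; lia.
  have jle : left_end a j <= i by move: eij; rewrite /ua_edge /left_end; lia.
  have Ej : i = left_end a j :> nat.
    apply/eqP; rewrite eqn_leq jle andbT leqNgt; apply/negP => lt.
    have lt' : i.-1 < n by have := ltn_ord i; lia.
    have /implyP/= := Hk' (Ordinal lt').
    by move: lt; rewrite /ua_edge /left_end /=; lia.
  split; first by apply/eqP.
  (* As j + 1 is not adjacent to i, its left end exceeds i; monotonicity extends this to every later
     k. *)
  apply/forallP => k; apply/implyP => jk; rewrite -Ej.
  have lt' : j.+1 < n by have := ltn_ord k; lia.
  apply: leq_trans (Hm (Ordinal lt') k jk).
  have /implyP/= := Hk (Ordinal lt').
  by rewrite eqxx /ua_edge /left_end /= => /(_ isT); lia.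
move=> [/eqP Ei /forallP Hk]; have := le j; rewrite -Ei leq_eqVlt.
move=> /orP[/eqP/val_inj ij|ij].
  subst j; rewrite eqxx /=; apply/orP; left; apply/forallP => k.
  have /implyP := Hk k; have := Hm k i; have := le k.
  by move: Ei; rewrite /ua_edge /left_end; lia.
apply/orP; right; rewrite ij /=; apply/and3P; split.
- by move: Ei; rewrite /ua_edge /left_end; lia.
- apply/forallP => k; apply/implyP => /eqP kj.
  have /implyP := Hk k; rewrite kj ltnSn => /(_ isT).
  by move: Ei; rewrite /ua_edge /left_end; lia.
- apply/forallP => k; apply/implyP => /eqP ki.
  by move: Ei; rewrite /ua_edge /left_end; lia.
Qed.

Lemma peak_nestingE n (a : {ffun 'I_n -> 'I_n}) v : is_area_seq a ->
  peak_nesting a v = #|[set j | block_end a j & left_end a j <= v <= j]|.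
Proof.
move=> Ha; have ltl j : left_end a j < n.
  by rewrite (leq_ltn_trans (leq_subr _ _)).
pose cl j := peak_clique (Ordinal (ltl j), j).
have mem_cl j k : (k \in cl j) = (left_end a j <= k <= j) by rewrite inE.
rewrite /peak_nesting.
have -> : [set C in peak_cliques a | v \in C]
  = [set cl j | j in [set j | block_end a j & left_end a j <= v <= j]].
  apply/setP => C; rewrite inE; apply/andP/imsetP.
    move=> [/imsetP[[i j]]]; rewrite inE peak_edgeE // => /andP[/eqP Ei Hj] -> vC.
    have Ei' : i = Ordinal (ltl j) by apply: val_inj.
    exists j; last by rewrite Ei'.
    by rewrite inE Hj; move: vC; rewrite inE /= Ei.
  move=> [j]; rewrite inE => /andP[Hj Hv] ->; split; last by rewrite mem_cl.
  by apply: imset_f; rewrite inE peak_edgeE // eqxx.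
(* A clique determines its block end, which is its largest vertex. *)
rewrite card_imset // => j k E; apply: val_inj; apply/eqP.
have : j \in cl k by rewrite -E mem_cl leqnn leq_subr.
have : k \in cl j by rewrite E mem_cl leqnn leq_subr.
by rewrite !mem_cl => /andP[_ kj] /andP[_ jk]; rewrite eqn_leq jk.
Qed.

Lemma pnestE m (a : {ffun 'I_m.+1 -> 'I_m.+1}) :
  a \in abelian_area_seqs m.+1 ->
  pnest a = #|[set j | block_end a j & left_end a ord_max <= j]|.
Proof.
rewrite inE => /andP[Ha /(abelianP Ha) H0]; have /area_seqP[Hle Hm] := Ha.
set l := left_end a ord_max in H0 *.
have lel j : left_end a j <= l by apply: Hm; rewrite -ltnS.
have lm : l < m.+1 by rewrite ltnS /l /left_end leq_subr.
apply/eqP; rewrite eqn_leq; apply/andP; split; last first.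
  (* The vertex l attains the bound, since no left end exceeds l. *)
  apply: leq_trans (leq_bigmax (Ordinal lm)); rewrite peak_nestingE //.
  apply/eq_leq/eq_card => j; rewrite !inE; congr (_ && _).
  by rewrite lel.
apply/bigmax_leqP => v _; rewrite peak_nestingE //.
have [lv|vl] := leqP l v.
  by apply/subset_leq_card/subsetP => j; rewrite !inE; lia.
(* A vertex left of [l] misses the last clique, and among the cliques ending
   left of [l] only the one ending at [l - 1] can occur. *)
set B := [set j : 'I_m.+1 | block_end a j & l <= j].
have maxB : ord_max \in B.
  rewrite !inE -ltnS lm andbT; apply/forallP => k; apply/implyP => /=.
  by have := ltn_ord k; lia.
have lt1 : l.-1 < m.+1 by lia.
rewrite (cardsD1 ord_max B) maxB add1n.
apply: leq_trans (_ : #|Ordinal lt1 |: (B :\ ord_max)| <= _); last first.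
  by rewrite cardsU1; case: (_ \notin _); lia.
apply/subset_leq_card/subsetP => j; rewrite !inE => /and3P[Hj jv vj].
have [lj|jl] := leqP l j.
  apply/orP; right; rewrite Hj !andbT; apply: contraTneq jv => ->.
  by rewrite -ltnNge.
apply/orP; left; apply/eqP/val_inj => /=.
(* If j < l - 1, the left ends of j and l - 1 are both 0, although a block end requires a strict
   increase. *)
have /forallP/(_ (Ordinal lt1))/implyP/= := Hj.
by rewrite !H0 //=; lia.
Qed.

(** On block ends [left_end] is injective, and each recorded height is reached at a block end,
    namely at the last vertex having it as left end. *)
Lemma pnest_word m w : size w = m ->
  pnest (area_of_word m w) = size (undup (staircase 0 w)).
Proof.
move=> sw; rewrite pnestE ?area_of_word_abelian // left_end_word_max //.
set a := area_of_word m w.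
have /area_seqP[Hle Hm] : is_area_seq a.
  by have := area_of_word_abelian sw; rewrite inE => /andP[].
rewrite cardE -(size_map (left_end a)); apply/perm_size/uniq_perm.
- rewrite map_inj_in_uniq ?enum_uniq // => i j; rewrite !mem_enum !inE.
  move=> /andP[/forallP Hi _] /andP[/forallP Hj _] E; apply: val_inj.
  have /implyP := Hi j; have /implyP := Hj i; rewrite E ltnn.
  by move=> /= H1 H2; case: (ltngtP i j) => // [/H2|/H1].
- exact: undup_uniq.
have stair_nth (i : 'I_m.+1) : count id w <= i ->
    left_end a i = nth 0 (staircase 0 w) (i - count id w).
  by move=> li; rewrite left_end_word nth_cat size_nseq ltnNge li.
have sz : count id w + size (staircase 0 w) = m.+1.
  by rewrite -[in RHS]sw -size_word_seq size_cat size_nseq.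
move=> x; rewrite mem_undup; apply/mapP/idP.
  move=> [j]; rewrite mem_enum inE => /andP[_ lj] ->; rewrite stair_nth //.
  by apply: mem_nth; rewrite ltn_subLR // sz.
move=> /(nthP 0)[i lti Ex].
have lti' : count id w + i < m.+1 by rewrite -sz ltn_add2l.
pose P (k : 'I_m.+1) := left_end a k == x.
have P0 : P (Ordinal lti').
  by rewrite /P stair_nth /= ?leq_addr // addKn Ex.
case: (@arg_maxnP _ _ P val P0) => j /eqP Pj jmax; exists j => //.
rewrite mem_enum inE; apply/andP; split.
  apply/forallP => k; apply/implyP => jk; rewrite ltn_neqAle Hm ?(ltnW jk) //.
  rewrite andbT; apply: contraTneq jk => E; rewrite -leqNgt.
  by apply: jmax; rewrite /P -E Pj.
by apply: leq_trans (jmax _ P0); rewrite /= leq_addr.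
Qed.

(** * The recurrence *)

Local Open Scope ring_scope.

Definition stair_sum (R : comNzRingType) (m c : nat) : {poly R} :=
  \sum_(w <- words m) 'X^(size (undup (staircase c w))).

(** The share of the words starting with [false], for which the height c is already recorded. *)
Definition repeat_sum (R : comNzRingType) (m c : nat) : {poly R} :=
  \sum_(w <- words m) 'X^(size (undup (c :: staircase c w))).

Lemma stair_sumS (R : comNzRingType) m c :
  stair_sum R m.+1 c = stair_sum R m c.+1 + repeat_sum R m c.
Proof. by rewrite /stair_sum big_cat !big_map. Qed.

(** Once the path rises, c never recurs and contributes a factor ['X]; recording c again adds no new
    value. *)
Lemma repeat_sumS (R : comNzRingType) m c :
  repeat_sum R m.+1 c = 'X * stair_sum R m c.+1 + repeat_sum R m c.
Proof.
rewrite /repeat_sum big_cat !big_map; congr (_ + _).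
  rewrite /stair_sum mulr_sumr; apply: eq_bigr => w _ /=.
  case: ifP => [/staircase_bounds|_]; first by lia.
  by rewrite exprS.
by apply: eq_bigr => w _ /=; rewrite inE eqxx.
Qed.

(** Translating all heights preserves the number of distinct ones; both sums are translated together
    because their recurrences are coupled. *)
Lemma stair_repeat_shift (R : comNzRingType) m c :
  stair_sum R m c = stair_sum R m 0 /\ repeat_sum R m c = repeat_sum R m 0.
Proof.
elim: m c => [|m IHm] c.
  by rewrite /stair_sum /repeat_sum !big_seq1 /= !inE !eqxx.
rewrite !stair_sumS !repeat_sumS.
by have [_ ->] := IHm c; have [-> _] := IHm c.+1; have [-> _] := IHm 1%N.
Qed.

(** Apply both recurrences once, then eliminate [repeat_sum] as the difference of two consecutive
    values of [stair_sum]. *)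
Lemma stair_sum_rec (R : comNzRingType) m :
  stair_sum R m.+2 0
  = 2%:R *: stair_sum R m.+1 0 + ('X - 1) * stair_sum R m 0.
Proof.
rewrite stair_sumS repeat_sumS (stair_repeat_shift R m.+1 1).1.
have := stair_sumS R m 0; rewrite (stair_repeat_shift R m 1).1 => ->.
by rewrite scaler_nat; ring.
Qed.

Lemma PnestAE (R : realType) m : PnestA R m.+1 = stair_sum R m 0.
Proof.
rewrite /PnestA /stair_sum.
have perm : perm_eq (enum (abelian_area_seqs m.+1)) (map (area_of_word m) (words m)).
  apply: uniq_perm; first exact: enum_uniq.
    rewrite map_inj_in_uniq ?words_uniq // => w w'; rewrite !mem_words.
    exact: area_of_word_inj.
  move=> a; rewrite mem_enum; apply/idP/mapP.
    by move=> /abelian_area_of_word[w sw ->]; exists w; rewrite ?mem_words ?sw.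
  by move=> [w]; rewrite mem_words => /eqP sw ->; apply: area_of_word_abelian.
rewrite -big_enum (perm_big _ perm) big_map big_seq [RHS]big_seq.
by apply: eq_bigr => w; rewrite mem_words => /eqP sw; rewrite pnest_word.
Qed.

(** * Zeros and interlacing *)

Section RealZeros.
Variable R : realType.

Lemma zeros_of_split (p : {poly R}) s : p != 0 -> sorted >=%R s ->
  p = lead_coef p *: \prod_(x <- s) ('X - x%:P) -> zeros_of p s.
Proof.
move=> p0 ss Ep; split=> // x; rewrite Ep -mul_polyC mupMr ?mu_prod_XsubC //.
by rewrite rootC lead_coef_eq0.
Qed.

Lemma real_rooted_split (p : {poly R}) s : p != 0 ->
  p = lead_coef p *: \prod_(x <- s) ('X - x%:P) -> real_rooted p.
Proof.
move=> p0 Ep; right => z.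
rewrite Ep map_polyZ /= rootZ ?fmorph_eq0 ?lead_coef_eq0 // rmorph_prod /=.
under eq_bigr do rewrite map_polyXsubC.
rewrite -(big_map (real_complex R) predT (fun y => 'X - y%:P)).
by rewrite root_prod_XsubC => /mapP[x _ ->]; apply/complex_realP; exists x.
Qed.

(** At - tan^2 t the factor X - 1 becomes - 1 / cos^2 t, so the recurrence turns into sin((m+3)t) =
    2 cos t sin((m+2)t) - sin((m+1)t). *)
Lemma stair_sum_horner m (t : R) : cos t != 0 ->
  (stair_sum R m 0).[- tan t ^+ 2] * cos t ^+ m.+2 = - sin t * sin (t *+ m.+1).
Proof.
move=> ct; elim/ltn_ind: m => -[|[|m]] IHm.
- rewrite /stair_sum big_seq1 /= hornerX /tan mulr1n.
  by field.
- rewrite stair_sumS /stair_sum /repeat_sum !big_seq1 /=.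
  by rewrite hornerD !hornerX /tan mulr2n sinD; field.
rewrite stair_sum_rec hornerD hornerZ hornerM -polyC1 hornerXsubC.
have := IHm m.+1 (ltnSn _); have := IHm m (leqW (ltnSn _)).
set p := horner _ _; set q := horner _ _ => Ep Eq.
have -> : - tan t ^+ 2 - 1 = - (cos t ^- 2) by rewrite cos2_tan2 //; ring.
have -> : (2%:R * q + - cos t ^- 2 * p) * cos t ^+ m.+4
        = 2%:R * cos t * (q * cos t ^+ m.+3) - p * cos t ^+ m.+2.
  by rewrite !exprS; field.
rewrite Ep Eq.
have -> : t *+ m.+3 = t *+ m.+2 + t by rewrite -mulrSr.
have -> : t *+ m.+1 = t *+ m.+2 - t by rewrite (mulrSr _ m.+1) addrK.
by rewrite !sinD cosN sinN; ring.
Qed.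

(** The degree bound grows by one every two steps, through the factor X - 1. *)
Lemma size_stair_sum_le m : (size (stair_sum R m 0) <= m./2.+2)%N.
Proof.
have sX1 : size ('X - 1 : {poly R}) = 2 by rewrite size_XsubC.
elim/ltn_ind: m => -[|[|m]] IHm.
- by rewrite /stair_sum big_seq1 size_polyX.
- rewrite stair_sumS /stair_sum /repeat_sum !big_seq1 /=.
  by rewrite (leq_trans (size_polyD _ _)) // size_polyX.
rewrite stair_sum_rec (leq_trans (size_polyD _ _)) // geq_max; apply/andP; split.
  rewrite (leq_trans (size_scale_leq _ _)) // (leq_trans (IHm m.+1 _)) //.
  by lia.
rewrite (leq_trans (size_polyMleq _ _)) // sX1.
by have := IHm m (leqW (ltnSn _)); rewrite /=; lia.
Qed.

Lemma stair_sum_neq0 m : stair_sum R m 0 != 0.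
Proof.
(* The value at 1 is the number of words. *)
apply/eqP => /(congr1 (horner^~ 1)); rewrite horner0 /stair_sum horner_sum.
under eq_bigr do rewrite hornerXn expr1n.
apply/eqP; rewrite big_const_seq count_predT iter_addr_0 pnatr_eq0.
rewrite size_eq0; apply/eqP => E.
by have := mem_words m (nseq m true); rewrite E size_nseq eqxx.
Qed.

Lemma stair_sum_lead_gt0 m : 0 < lead_coef (stair_sum R m 0).
Proof.
rewrite lt0r lead_coef_eq0 stair_sum_neq0 lead_coefE /stair_sum coef_sum.
by apply: sumr_ge0 => w _; rewrite coefXn ler0n.
Qed.

Definition angle (n k : nat) : R := k%:R * pi / n%:R.

Lemma angle_itv n k : (k.*2 < n)%N -> 0 <= angle n k < pi / 2.
Proof.
move=> kn; have n0 : 0 < n%:R :> R by rewrite ltr0n; lia.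
rewrite divr_ge0 ?mulr_ge0 ?pi_ge0 ?ler0n //=.
rewrite ltr_pdivrMr // mulrAC ltr_pdivlMr ?ltr0n // mulrC mulrA.
by rewrite mulrC ltr_pM2l ?pi_gt0 // -natrM ltr_nat; lia.
Qed.

Lemma ltr_Ntan2 : {in [pred x : R | 0 <= x < pi / 2] &,
  {mono (fun x => - tan x ^+ 2) : x y /~ x < y}}.
Proof.
move=> x y /andP[x0 x1] /andP[y0 y1].
have N0 : - (pi / 2) < 0 :> R by rewrite oppr_lt0 divr_gt0 ?pi_gt0.
have itv (z : R) : 0 <= z -> z < pi / 2 -> z \in `](- (pi / 2)), (pi / 2)[.
  by move=> z0 z1; rewrite in_itv /= z1 (lt_le_trans N0).
have tan_ge0 (z : R) : 0 <= z -> z < pi / 2 -> 0 <= tan z.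
  move=> z0 z1; rewrite -tan0 leNgt ltr_tan ?itv // -?leNgt //.
  by rewrite divr_gt0 ?pi_gt0.
by rewrite ltrN2 ltr_sqr ?nnegrE ?tan_ge0 // ltr_tan ?itv.
Qed.

(** The range k <= m / 2 is exactly the one in which the angle k pi / (m + 1) stays below pi / 2;
    there - tan^2 is strictly decreasing, so the list is too. *)
Definition stair_zeros (m : nat) : seq R :=
  [seq - tan (angle m.+1 k) ^+ 2 | k <- iota 0 (m./2).+1].

Lemma size_stair_zeros m : size (stair_zeros m) = m./2.+1.
Proof. by rewrite size_map size_iota. Qed.

Lemma nth_stair_zeros m i : (i <= m./2)%N ->
  (stair_zeros m)`_i = - tan (angle m.+1 i) ^+ 2.
Proof. by move=> im; rewrite (nth_map 0%N) ?size_iota // nth_iota. Qed.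

Lemma stair_zeros_sorted m : sorted >%R (stair_zeros m).
Proof.
rewrite /stair_zeros; apply: (@homo_sorted_in _ _ [pred k | k <= m./2]%N _ ltn).
- move=> i j; rewrite !inE => im jm ij /=.
  rewrite ltr_Ntan2 ?inE ?angle_itv //; try by lia.
  rewrite ltr_pM2r ?invr_gt0 ?ltr0n // ltr_pM2r ?pi_gt0 //.
  by rewrite ltr_nat.
- by apply/allP => i; rewrite mem_iota.
- exact: iota_ltn_sorted.
Qed.

Lemma stair_zeros_root m : all (root (stair_sum R m 0)) (stair_zeros m).
Proof.
apply/allP => x /mapP[k]; rewrite mem_iota => /andP[_ km] ->.
have /angle_itv/andP[t0 t1] : (k.*2 < m.+1)%N by lia.
have ct : cos (angle m.+1 k) != 0.
  rewrite gt_eqF // cos_gt0_pihalf // t1 andbT (lt_le_trans _ t0) //.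
  by rewrite oppr_lt0 divr_gt0 ?pi_gt0.
have := stair_sum_horner m ct.
have -> : angle m.+1 k *+ m.+1 = pi *+ k.
  by rewrite -mulr_natr divfK ?pnatr_eq0 // mulr_natl.
have -> : sin (pi *+ k) = 0 :> R.
  by elim: k {km t0 t1 ct} => [|k IHk]; rewrite ?sin0 // mulrSr sinDpi IHk oppr0.
by move/eqP; rewrite mulr0 mulf_eq0 expf_eq0 (negbTE ct) andbF orbF.
Qed.

Lemma stair_sum_split m :
  stair_sum R m 0
  = lead_coef (stair_sum R m 0) *: \prod_(x <- stair_zeros m) ('X - x%:P).
Proof.
have us : uniq (stair_zeros m).
  apply: sorted_uniq (stair_zeros_sorted m); last exact: ltxx.
  by move=> x y z /= xy zx; apply: lt_trans zx xy.
apply: all_roots_prod_XsubC; rewrite ?uniq_rootsE ?stair_zeros_root //.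
(* The known distinct roots are as many as the degree bound allows, so the degree is exact and there
   are no other zeros. *)
apply/eqP; rewrite eqn_leq size_stair_zeros size_stair_sum_le -size_stair_zeros.
by rewrite max_poly_roots ?stair_sum_neq0 ?stair_zeros_root.
Qed.

Lemma stair_zeros_of m : zeros_of (stair_sum R m 0) (stair_zeros m).
Proof.
apply: zeros_of_split (stair_sum_neq0 m) _ (stair_sum_split m).
apply: sub_sorted (stair_zeros_sorted m) => x y; exact: ltW.
Qed.

Lemma stair_sum_real_rooted_pos m : real_rooted_pos (stair_sum R m 0).
Proof.
split; last exact: stair_sum_lead_gt0.
exact: real_rooted_split (stair_sum_neq0 m) (stair_sum_split m).
Qed.

Lemma stair_zeros_interlacing m :
  interlacing_seqs (stair_zeros m) (stair_zeros m.+1).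
Proof.
(* The hypothesis compares i' / (n' + 1) with i / (n + 1), that is, the two angles, whose order -
   tan^2 reverses. *)
have le_zeros n n' i i' : (i <= n./2)%N -> (i' <= n'./2)%N ->
    (i' * n.+1 <= i * n'.+1)%N ->
    (stair_zeros n)`_i <= (stair_zeros n')`_i'.
  move=> im im' ii'; rewrite !nth_stair_zeros // leNgt.
  rewrite ltr_Ntan2 ?inE ?angle_itv //; try by lia.
  rewrite -leNgt /angle ler_pdivrMr ?ltr0n // mulrAC ler_pdivlMr ?ltr0n //.
  by rewrite mulrAC (mulrAC _ pi) ler_pM2r ?pi_gt0 // -!natrM ler_nat.
rewrite /interlacing_seqs !size_stair_zeros; split=> [|i im|i im].
- by lia.
- by apply: le_zeros; lia.
(* Here i (m + 2) <= (i + 1) (m + 1), because i <= m + 1. *)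
- by apply: le_zeros; lia.
Qed.

End RealZeros.

Theorem corollary4p5 (R : realType) :
  [/\ PnestA R 0 = 1,
      PnestA R 1 = 'X,
      PnestA R 2 = 2%:R *: 'X,
      forall n : nat, (3 <= n)%N ->
        PnestA R n = 2%:R *: PnestA R n.-1 + ('X - 1) * PnestA R n.-2
    & (forall n : nat, real_rooted (PnestA R n)) /\
      generalized_sturm (PnestA R)].
Proof.
have rr n : real_rooted_pos (PnestA R n).
  case: n => [|m]; last by rewrite PnestAE; apply: stair_sum_real_rooted_pos.
  by split; [left; rewrite size_poly1 | rewrite lead_coef1 ltr01].
split=> //.
- by rewrite PnestAE /stair_sum big_seq1.
- rewrite PnestAE stair_sumS /stair_sum /repeat_sum !big_seq1 /=.
  by rewrite scaler_nat mulr2n.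
- by case=> [|[|[|m]]] // _; rewrite !PnestAE stair_sum_rec.
split=> [n|]; first by case: (rr n).
split=> // -[|[|m]] // _; split; try by right; apply: rr.
  (* The constant 1 has no zeros and ['X] has a single one, so no inequality between zeros remains
     to be checked. *)
  move=> _ _; exists [::], (stair_zeros R 0); split.
  - by split=> // x; rewrite mupNroot // root1.
  - by rewrite PnestAE; apply: stair_zeros_of.
  - by split=> //; rewrite size_stair_zeros.
move=> _ _; exists (stair_zeros R m), (stair_zeros R m.+1).
by rewrite !PnestAE; split; [exact: stair_zeros_of..|exact: stair_zeros_interlacing].
Qed.
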